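(* Let $C > 1$ be a fixed constant. Then for all sufficiently large $s$, \[ r(s, Cs) \ge \left(2^{1 - \frac{1}{2C}}\right)^s. \]
   Context: For positive integers $s,k$, the Ramsey number $r(s,k)$ is the minimum integer $n$ such that every graph on $n$ vertices contains a clique of size $s$ or an independent set of size $k$. Floors and ceilings are omitted (so $Cs$ is understood as an integer rounding of $Cs$). *)

(* Defs.v *)
From Stdlib Require Import Reals ClassicalEpsilon.
From mathcomp Require Import all_boot.

Set Implicit Arguments.
Unset Strict Implicit.
Unset Printing Implicit Defensive.

(* A simple graph on the vertex set 'I_n is given by a set E of edges,
   where an edge between distinct x, y is the 2-element set [set x; y].
   (Elements of E that are not 2-element sets are irrelevant.) *)

Definition is_clique (n : nat) (E : {set {set 'I_n}}) (S : {set 'I_n}) : bool :=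
  [forall x in S, forall y in S, (x != y) ==> ([set x; y] \in E)].

Definition is_indep (n : nat) (E : {set {set 'I_n}}) (S : {set 'I_n}) : bool :=
  [forall x in S, forall y in S, (x != y) ==> ([set x; y] \notin E)].

Definition ramsey_prop (s k : nat) (n : nat) : bool :=
  [forall E : {set {set 'I_n}},
     [exists S : {set 'I_n}, (#|S| == s) && is_clique E S]
  || [exists S : {set 'I_n}, (#|S| == k) && is_indep E S]].

(* r(s,k) = the minimum n such that ramsey_prop s k n holds.
   (Such n always exists by Ramsey's theorem; the default 0 in the
   other branch is never used.) *)
Definition ramsey (s k : nat) : nat :=
  match excluded_middle_informative (exists n, ramsey_prop s k n) with
  | left h => ex_minn h
  | right _ => 0
  end.

(* floor of a real number, as a natural number (0 for negatives) *)
Definition nat_floor (x : R) : nat := Z.to_nat (Int_part x).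

(* Main.v *)
Require Import Defs.
From HB Require Import structures.
From Stdlib Require Import Reals Lra ClassicalEpsilon.
From mathcomp Require Import all_boot all_algebra mxabelem.
From mathcomp Require Import zify.

(* Take d = s - 2 and give each of n vertices an independent uniform pair (a, b)
   of vectors of F_2^d with a . b = 0, joining vertices i < j when a_i . b_j = 1.
   A clique of size d + 2 is impossible, since the matrix (a_i . b_j) has rank
   at most d.  In an independent set each b_j is orthogonal to the span A of the
   previous a_i's: if rank A = r, this has probability about 2^-r, and then a_j
   lies in A only with probability 2^(r-d).  Hence, up to constant factors per vertex,
   the likeliest way to be independent is that the a_j's span F_2^d as
   quickly as possible, and k vertices are independent with probability at most
   2^(O(k) - d k + d^2/2).  The union bound over the k-subsets, where the factor
   1/k! beats 2^O(k), leaves room for n = 2^(s - s^2/(2k)) vertices. *)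

Set Implicit Arguments.
Unset Strict Implicit.
Unset Printing Implicit Defensive.

Import GRing.Theory.

(** * Finiteness of Ramsey numbers *)

Lemma is_indepE (n : nat) (E : {set {set 'I_n}}) (S : {set 'I_n}) :
  is_indep E S = is_clique (~: E) S.
Proof. by do 2![apply: eq_forallb_in => ? _]; rewrite inE. Qed.

Lemma is_cliqueU1 (n : nat) (E : {set {set 'I_n}}) (v : 'I_n) (S : {set 'I_n}) :
  is_clique E S -> (forall x, x \in S -> [set v; x] \in E) ->
  is_clique E (v |: S).
Proof.
move=> /forall_inP clS vx; apply/forall_inP => x; rewrite !inE => /orP[/eqP->|xS];
  apply/forall_inP => y; rewrite !inE => /orP[/eqP->|yS]; apply/implyP.
- by rewrite eqxx.
- by rewrite vx.
- by rewrite setUC vx.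
- by apply/implyP; move/(_ x xS)/forall_inP: clS => /(_ y yS).
Qed.

(** Induction on [s + k] through the neighbours and non-neighbours of a vertex. Working inside a
    subset [V] avoids relabelling vertices. *)
Lemma clique_or_indep_of_exp (n : nat) (E : {set {set 'I_n}}) (s k : nat)
    (V : {set 'I_n}) :
  2 ^ (s + k) <= #|V| ->
  [exists S : {set 'I_n}, [&& S \subset V, #|S| == s & is_clique E S]]
  || [exists S : {set 'I_n}, [&& S \subset V, #|S| == k & is_indep E S]].
Proof.
(* With independent sets seen as cliques of [~: E], [extend] and [widen] serve both cases. *)
under [X in _ || X]eq_existsb => S do rewrite is_indepE.
have clique0 E' : is_clique E' (set0 : {set 'I_n}).
  by apply/forall_inP => x; rewrite inE.
have [m] := ubnP (s + k); elim: m s k V => // m IHm [|s] k V.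
  by move=> _ _; apply/orP; left; apply/existsP; exists set0; rewrite sub0set cards0 clique0.
case: k => [|k].
  by move=> _ _; apply/orP; right; apply/existsP; exists set0; rewrite sub0set cards0 clique0.
move=> lt_m le_V.
have /card_gt0P[v vV] : 0 < #|V| by apply: leq_trans le_V; rewrite expn_gt0.
pose N (E' : {set {set 'I_n}}) := [set x in V :\ v | [set v; x] \in E'].
have NV E' : N E' \subset V by apply/subsetP => x; rewrite !inE => /andP[/andP[]].
have cardN : #|N E| + #|N (~: E)| + 1 = #|V|.
  rewrite (cardsD1 v V) vV -(cardsID [set x | [set v; x] \in E] (V :\ v)).
  rewrite addnC; congr (_ + (_ + _)); apply: eq_card => x.
    by rewrite !inE.
  by rewrite !inE andbC.
have extend (E' : {set {set 'I_n}}) (S : {set 'I_n}) (c : nat) :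
    [&& S \subset N E', #|S| == c & is_clique E' S] ->
    [exists S : {set 'I_n}, [&& S \subset V, #|S| == c.+1 & is_clique E' S]].
  case/and3P=> SN /eqP cS clS; apply/existsP; exists (v |: S).
  have vS : v \notin S by apply/negP => /(subsetP SN); rewrite !inE eqxx.
  rewrite subUset sub1set vV (subset_trans SN (NV E')) cardsU1 vS cS eqxx /=.
  by apply: is_cliqueU1 => // x /(subsetP SN); rewrite inE => /andP[].
have widen (E' E2 : {set {set 'I_n}}) (c : nat) :
    [exists S : {set 'I_n}, [&& S \subset N E2, #|S| == c & is_clique E' S]] ->
    [exists S : {set 'I_n}, [&& S \subset V, #|S| == c & is_clique E' S]].
  case/existsP=> S /and3P[SN cS clS]; apply/existsP; exists S.
  by rewrite (subset_trans SN (NV E2)) cS.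
have [le_N|lt_N] := leqP (2 ^ (s + k.+1)) #|N E|.
  have lt_m' : s + k.+1 < m by lia.
  case/orP: (IHm s k.+1 _ lt_m' le_N) => [/existsP[S /extend->] //|/widen->].
  exact: orbT.
have le_M : 2 ^ (s.+1 + k) <= #|N (~: E)|.
  move: le_V lt_N; rewrite !addSn !addnS !expnS -cardN; lia.
have lt_m' : s.+1 + k < m by lia.
case/orP: (IHm s.+1 k _ lt_m' le_M) => [/widen->|/existsP[S /extend->]] //.
exact: orbT.
Qed.

Lemma ramsey_prop_exp (s k : nat) : ramsey_prop s k (2 ^ (s + k)).
Proof.
apply/forallP => E.
have := @clique_or_indep_of_exp _ E s k setT; rewrite cardsT card_ord leqnn.
case/(_ isT)/orP => /existsP[S /and3P[_ cS hS]]; apply/orP; [left|right];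
  by apply/existsP; exists S; rewrite cS.
Qed.

(** Ramsey's theorem rules out the default branch of [ramsey]. The lower bound comes from
    contradicting this property. *)
Lemma ramsey_propP (s k : nat) : ramsey_prop s k (ramsey s k).
Proof.
rewrite /ramsey; case: excluded_middle_informative => [h|[]].
  by case: ex_minnP.
by exists (2 ^ (s + k)); apply: ramsey_prop_exp.
Qed.

(** * Pairs of vectors over F_2 and orthogonality *)

Definition F2pair (d : nat) : Type := ('rV['F_2]_d * 'rV['F_2]_d)%type.
HB.instance Definition _ d := Finite.on (F2pair d).

Definition dot1 (d : nat) (t u : F2pair d) : bool := (t.1 *m u.2^T != 0)%R.

Definition orth (d : nat) (A : 'M['F_2]_d) (t : F2pair d) : bool :=
  (A <= kermx t.2^T)%MS.

Definition selforth (d : nat) : {set F2pair d} := [set t | ~~ dot1 t t].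

(** An independent set under construction constrains its next member only through the row space of
    its first components, so [A] is all the state required. *)
Lemma orth_adds (d : nat) (A : 'M['F_2]_d) (t u : F2pair d) :
  orth (A + t.1)%MS u = orth A u && ~~ dot1 t u.
Proof. by rewrite /orth addsmx_sub [(t.1 <= _)%MS]sub_kermx negbK. Qed.

Lemma card_orthogonal (F : finFieldType) (m d : nat) (A : 'M[F]_(m, d)) :
  #|[set b : 'rV[F]_d | (A <= kermx b^T)%MS]| = #|F| ^ (d - \rank A).
Proof.
rewrite -mxrank_tr -mxrank_ker -card_rowg.
congr #|pred_of_set _|; apply/setP => b.
rewrite mem_rowg inE !sub_kermx -(inj_eq trmx_inj).
by rewrite trmx_mul trmxK trmx0.
Qed.

Lemma mxrank_adds_row (F : fieldType) (m d : nat) (A : 'M[F]_(m, d)) (a : 'rV[F]_d) :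
  ~~ (a <= A)%MS -> \rank (A + a)%MS = (\rank A).+1.
Proof.
move=> aA; apply/eqP; rewrite eqn_leq; apply/andP; split.
  rewrite -[(\rank A).+1]addn1; apply: leq_trans (mxrank_adds_leqif A a) _.
  by rewrite leq_add2l rank_leq_row.
rewrite ltnNge; apply: contra aA => le_r.
have sAa : (A + a <= A)%MS.
  have [_ <-] := mxrank_leqif_sup (addsmxSl A a).
  by rewrite eqn_leq le_r mxrankS ?addsmxSl.
exact: submx_trans (addsmxSr A a) sAa.
Qed.

(* A is the span of the first components chosen so far; with A = 0 this counts
   the independent sets of size m in the graph of w. *)
Fixpoint orth_subseqs (d : nat) (A : 'M['F_2]_d) (w : seq (F2pair d)) (m : nat)
    : nat :=
  match w, m with
  | _, 0 => 1
  | [::], _.+1 => 0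
  | t :: w', m'.+1 =>
      orth_subseqs A w' m
      + (if orth A t then orth_subseqs (A + t.1)%MS w' m' else 0)
  end.

(** The branch of the recursion that selects the entries of [u] contributes 1. Hence a zero count
    excludes independent sets of that size. *)
Lemma orth_subseqs_gt0 (d : nat) (w u : seq (F2pair d)) (A : 'M['F_2]_d) :
  subseq u w -> pairwise (fun t t' => ~~ dot1 t t') u -> all (orth A) u ->
  0 < orth_subseqs A w (size u).
Proof.
elim: w u A => [|t w IHw] [|x u] A //=.
case: eqP => [->|_] suw /andP[xu pu] /andP[Ax Au]; rewrite addn_gt0.
  rewrite Ax IHw ?orbT //; apply/allP => y yu.
  by rewrite orth_adds (allP Au) ?(allP xu).
by have /= -> := IHw (x :: u) A suw; rewrite //= ?xu ?pu ?Ax ?Au.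
Qed.

(** * First moment of the number of independent sets *)

(** An expectation over [n] independent uniform elements of [P], scaled by [#|P| ^ n] to stay in
    [nat]. *)
Fixpoint sum_seqs (T : finType) (P : {set T}) (n : nat) (f : seq T -> nat) : nat :=
  if n is n'.+1 then \sum_(t in P) sum_seqs P n' (fun w => f (t :: w)) else f [::].

Lemma sum_seqs_const (T : finType) (P : {set T}) (n c : nat) :
  sum_seqs P n (fun=> c) = #|P| ^ n * c.
Proof.
elim: n => [|n IHn] /=; first by rewrite mul1n.
by under eq_bigr do rewrite IHn; rewrite sum_nat_const expnS mulnA.
Qed.

Lemma sum_seqsD (T : finType) (P : {set T}) (n : nat) (f g : seq T -> nat) :
  sum_seqs P n (fun w => f w + g w) = sum_seqs P n f + sum_seqs P n g.
Proof.
elim: n f g => //= n IHn f g; rewrite -big_split /=.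
by apply: eq_bigr => t _; rewrite IHn.
Qed.

(** First moment method: a natural-valued [f] with mean below 1 vanishes somewhere. The entries are
    chosen one by one, keeping the conditional mean below 1. *)
Lemma sum_seqs_lt (T : finType) (P : {set T}) (n : nat) (f : seq T -> nat) :
  sum_seqs P n f < #|P| ^ n ->
  exists w : seq T, [/\ size w = n, all (mem P) w & f w = 0].
Proof.
elim: n f => [|n IHn] f /=; first by rewrite expn0 ltnS leqn0 => /eqP; exists [::].
move=> lt_f.
have [t tP lt_t] : exists2 t, t \in P &
    sum_seqs P n (fun w => f (t :: w)) < #|P| ^ n.
  apply/exists_inP; apply: contraLR lt_f; rewrite -leqNgt => /exists_inPn ge_f.
  rewrite expnS -sum_nat_const; apply: leq_sum => t tP.
  by rewrite leqNgt ge_f.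
have [w [sw wP fw]] := IHn _ lt_t.
by exists (t :: w); split=> //; [rewrite /= sw | apply/andP].
Qed.

(* Each step from rank r contributes 2 * 2^(2d - r): at most 2^(2d - r) pairs that
   increase the rank, and as much again for the pairs that do not.  The
   subtraction is truncated, so the factor stays at 2^(d+1) once r >= d. *)
Definition orth_bound (d m r : nat) : nat :=
  2 ^ (d.+1 * m + \sum_(i < m) (d - (r + i))).

Lemma orth_boundS (d m r : nat) :
  orth_bound d m.+1 r = 2 ^ (d.+1 + (d - r)) * orth_bound d m r.+1.
Proof.
rewrite /orth_bound -expnD big_ord_recl addn0 mulnS; congr (2 ^ _).
under eq_bigr => i _ do rewrite /= /bump /= add1n addnS -addSn.
by rewrite addnACA.
Qed.

(** The exponents differ by the last term [d - (r + m)]. This is the price of a step that leaves the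
    rank at [r]. *)
Lemma orth_bound_shift (d m r : nat) :
  orth_bound d m r <= 2 ^ (d - r) * orth_bound d m r.+1.
Proof.
rewrite /orth_bound -expnD leq_exp2l //.
have -> : \sum_(i < m) (d - (r.+1 + i)) = \sum_(i < m.+1) (d - (r + i)) - (d - r).
  rewrite big_ord_recl addn0 addKn; apply: eq_bigr => i _.
  by rewrite /= /bump /= add1n addnS addSn.
rewrite addnCA leq_add2l -maxnE; apply: leq_trans (leq_maxr _ _).
by rewrite big_ord_recr leq_addr.
Qed.

(** Each [a] has [2 ^ (d - r)] partners [b]. The [2 ^ r] vectors [a] in [A] each lose at most
    [2 ^ (d - r)] by the shift, and at most [2 ^ d] others raise the rank, so both cases give at
    most [2 ^ d] times the bound at [r.+1]. *)
Lemma sum_orth_bound (d m : nat) (A : 'M['F_2]_d) :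
  \sum_(t : F2pair d | orth A t) orth_bound d m (\rank (A + t.1)%MS)
    <= orth_bound d m.+1 (\rank A).
Proof.
set r := \rank A.
have rd : r <= d := rank_leq_row A.
have -> : \sum_(t : F2pair d | orth A t) orth_bound d m (\rank (A + t.1)%MS)
   = \sum_(a : 'rV['F_2]_d) 2 ^ (d - r) * orth_bound d m (\rank (A + a)%MS).
  rewrite -(pair_big_dep (fun=> true)
    (fun _ (b : 'rV['F_2]_d) => (A <= kermx b^T)%MS)
    (fun (a _ : 'rV['F_2]_d) => orth_bound d m (\rank (A + a)%MS))) /=.
  apply: eq_bigr => a _; rewrite sum_nat_cond_const -[X in X ^ _](@card_Fp 2) //.
  rewrite -card_orthogonal; by congr (_ * _); apply: eq_card => b; rewrite !inE.
rewrite -big_distrr /= orth_boundS expnD mulnAC [leqRHS]mulnC leq_mul2l.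
apply/orP; right.
rewrite (bigID (fun a : 'rV['F_2]_d => (a <= A)%MS)) /= expnS mul2n -addnn mulnDl.
apply: leq_add.
  have -> : \sum_(a : 'rV['F_2]_d | (a <= A)%MS) orth_bound d m (\rank (A + a)%MS)
     = 2 ^ r * orth_bound d m r.
    have -> : 2 ^ r = #|[set a : 'rV['F_2]_d | (a <= A)%MS]|.
      by rewrite -[LHS](congr1 (fun q => q ^ r) (@card_Fp 2 isT)) -card_rowg.
    rewrite -sum_nat_const; apply: eq_big => [a|a aA]; first by rewrite inE.
    by rewrite (addsmx_idPl aA).
  rewrite -{2}(subnKC rd) expnD -mulnA leq_mul2l orth_bound_shift orbT //.
apply: (@leq_trans (\sum_(a : 'rV['F_2]_d | ~~ (a <= A)%MS) orth_bound d m r.+1)).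
  by apply: leq_sum => a /mxrank_adds_row ->.
rewrite sum_nat_cond_const leq_mul2r; apply/orP; right.
by apply: leq_trans (max_card _) _; rewrite card_mx card_Fp // mul1n.
Qed.

(** Pascal's rule matches the recursion: the first pair is either skipped or selected. *)
Lemma sum_seqs_orth_subseqs (d n m : nat) (A : 'M['F_2]_d) :
  sum_seqs (selforth d) n (fun w => orth_subseqs A w m) * #|selforth d| ^ m
    <= 'C(n, m) * #|selforth d| ^ n * orth_bound d m (\rank A).
Proof.
set K := #|_|; elim: n m A => [|n IHn] [|m] A.
- by rewrite /= /orth_bound muln0 big_ord0.
- by rewrite /= mul0n.
- rewrite (_ : orth_bound _ _ _ = 1) ?muln1; last by rewrite /orth_bound muln0 big_ord0.
  rewrite bin0 mul1n [sum_seqs _ _ _](_ : _ = sum_seqs (selforth d) n.+1 (fun=> 1)) //.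
  by rewrite sum_seqs_const muln1.
rewrite /=.
under eq_bigr do rewrite sum_seqsD.
rewrite big_split /= sum_nat_const -/K binS !mulnDl.
have bnd c A' : 'C(n, c) * K ^ n.+1 * orth_bound d m.+1 A'
    = K * ('C(n, c) * K ^ n * orth_bound d m.+1 A').
  by rewrite expnS mulnCA -!mulnA.
apply: leq_add; first by rewrite bnd -[leqLHS]mulnA leq_mul2l IHn orbT.
(* The sum is enlarged from [selforth d] to all pairs, where [sum_orth_bound] applies. *)
apply: (@leq_trans (\sum_(t : F2pair d | orth A t)
   (K * ('C(n, m) * K ^ n) * orth_bound d m (\rank (A + t.1)%MS)))).
  rewrite big_distrl [leqRHS]big_mkcond [leqLHS]big_mkcond /=; apply: leq_sum => t _.
  case: ifP => _ //; case: ifP => _; last by rewrite sum_seqs_const muln0.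
  by rewrite expnS mulnCA -mulnA leq_mul2l IHn orbT.
by rewrite -big_distrr bnd [leqRHS]mulnA leq_mul2l sum_orth_bound orbT.
Qed.

(** A single vector has rank at most 1, so for each [a] at least half of all [b] are orthogonal to
    it. *)
Lemma card_selforth (d : nat) : 2 ^ (2 * d) <= 2 * #|selforth d|.
Proof.
have -> : #|selforth d| = \sum_(a : 'rV['F_2]_d) 2 ^ (d - \rank a).
  have -> : #|selforth d| =
      \sum_(t : F2pair d | true && (t.1 <= kermx t.2^T)%MS) 1.
    by rewrite -sum1_card; apply: eq_bigl => t; rewrite inE negbK sub_kermx.
  rewrite -(pair_big_dep (fun=> true)
    (fun (a b : 'rV['F_2]_d) => (a <= kermx b^T)%MS) (fun _ _ => 1)) /=.
  apply: eq_bigr => a _; rewrite sum1_card -[X in X ^ _](@card_Fp 2) //.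
  by rewrite -card_orthogonal; apply: eq_card => b; rewrite inE.
have -> : 2 ^ (2 * d) = \sum_(a : 'rV['F_2]_d) 2 ^ d.
  by rewrite sum_nat_const card_mx card_Fp // mul1n -expnD addnn mul2n.
rewrite big_distrr /=; apply: leq_sum => a _; rewrite -expnS leq_exp2l //.
by have := rank_leq_row a; lia.
Qed.

(* With M the Gram matrix of the pairs, J - M is unitriangular, so M has corank
   at most 1; but M factors through dimension d. *)
Lemma size_pairwise_dot1 (d : nat) (u : seq (F2pair d)) :
  pairwise (@dot1 d) u -> {subset u <= selforth d} -> size u <= d.+1.
Proof.
move=> pu su; set s := size u.
pose t0 : F2pair d := (0%R, 0%R).
pose U : 'M['F_2]_(s, d) := (\matrix_(p < s) (nth t0 u p).1)%R.
pose V : 'M['F_2]_(s, d) := (\matrix_(p < s) (nth t0 u p).2)%R.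
pose J : 'M['F_2]_s := ((const_mx 1 : 'cV_s) *m (const_mx 1 : 'rV_s))%R.
have UVE p q : ((U *m V^T) p q = ((nth t0 u p).1 *m (nth t0 u q).2^T) 0 0)%R.
  by rewrite !mxE; apply: eq_bigr => k _; rewrite !mxE.
have JE p q : (J p q = 1)%R by rewrite !mxE big_ord1 !mxE mulr1.
(* Over F_2 a nonzero scalar is 1, so Gram entries are truth values of [dot1]. *)
have dotE (t t' : F2pair d) : ((t.1 *m t'.2^T) 0 0 = (dot1 t t')%:R :> 'F_2)%R.
  rewrite /dot1; set M := (_ *m _)%R.
  have -> : (M == 0)%R = (M 0 0 == 0)%R.
    apply/eqP/eqP => [->|M0]; first by rewrite mxE.
    by apply/matrixP => i j; rewrite !ord1 M0 mxE.
  by case: (M _ _) => [[|[|]]] //= ?; apply: val_inj.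
have BE p q : ((J - U *m V^T) p q = 1 - (dot1 (nth t0 u p) (nth t0 u q))%:R)%R.
  by rewrite mxE JE mxE UVE dotE.
have trig : is_trig_mx (J - U *m V^T)%R.
  apply/is_trig_mxP => i j ij; rewrite BE.
  by rewrite (pairwiseP t0 pu) ?inE ?subrr.
have rk : \rank (J - U *m V^T)%R = s.
  apply: mxrank_unit; rewrite unitmxE det_trig // big1 ?unitr1 // => i _.
  rewrite BE; have /su := mem_nth t0 (ltn_ord i).
  by rewrite inE => /negbTE ->; rewrite subr0.
rewrite -rk; apply: leq_trans (mxrank_add _ _) _.
rewrite mxrank_opp -[d.+1]add1n leq_add //.
  exact: leq_trans (mxrankM_maxl _ _) (rank_leq_col _).
exact: leq_trans (mxrankM_maxl _ _) (rank_leq_col _).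
Qed.

(** * From sequences of pairs to graphs *)

(** Since [dot1] is not symmetric, the order of the vertices decides which one supplies the first
    component. *)
Definition dot_graph (d n : nat) (w : seq (F2pair d)) : {set {set 'I_n}} :=
  [set e | [exists x : 'I_n, exists y : 'I_n,
     [&& x < y, e == [set x; y] & dot1 (nth (0, 0)%R w x) (nth (0, 0)%R w y)]]].

Lemma set2_ltn_inj (n : nat) (x y x' y' : 'I_n) :
  x < y -> x' < y' -> [set x; y] = [set x'; y'] -> x = x' /\ y = y'.
Proof.
move=> xy x'y' /setP e; have := e x'; have := e y'; rewrite !inE !eqxx orbT /=.
case/orP=> /eqP y'E; case/orP=> /eqP x'E; subst x' y' => //;
  by rewrite ?ltnn // ltnNge ltnW in x'y'.
Qed.

Lemma mem_dot_graph (d n : nat) (w : seq (F2pair d)) (x y : 'I_n) :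
  x < y ->
  ([set x; y] \in dot_graph n w) = dot1 (nth (0, 0)%R w x) (nth (0, 0)%R w y).
Proof.
move=> xy; rewrite inE; apply/existsP/idP => [[x' /existsP[y']]|h]; last first.
  by exists x; apply/existsP; exists y; rewrite xy eqxx.
by case/and3P=> x'y' /eqP/(set2_ltn_inj xy x'y')[-> ->].
Qed.

Lemma pairwise_enum_ord (n : nat) (S : {set 'I_n}) :
  pairwise (fun x y : 'I_n => x < y) (enum S).
Proof.
rewrite /enum_mem; apply: pairwise_filter.
rewrite -[pairwise _ _](pairwise_map val ltn) -enumT val_enum_ord.
by rewrite -(sorted_pairwise ltn_trans) iota_ltn_sorted.
Qed.

(** The hypothesis makes the expected number of independent [k]-sets less than 1, while cliques of
    size [d.+2] are excluded for every choice of pairs. *)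
Lemma ramsey_prop_gt (d k n : nat) :
  'C(n, k) * orth_bound d k 0 < #|selforth d| ^ k -> ~~ ramsey_prop d.+2 k n.
Proof.
move=> ltK; set K := #|_| in ltK.
have K0 : 0 < K by have := card_selforth d; have := expn_gt0 2 (2 * d); lia.
have [w [sw wP w0]] : exists w : seq (F2pair d),
    [/\ size w = n, all (mem (selforth d)) w & orth_subseqs 0%R w k = 0].
  apply: sum_seqs_lt; rewrite -(ltn_pmul2r (_ : 0 < K ^ k)) ?expn_gt0 ?K0 //.
  apply: leq_ltn_trans (sum_seqs_orth_subseqs _ _ _) _.
  by rewrite mxrank0 mulnAC -/K [ltnRHS]mulnC ltn_pmul2r // expn_gt0 K0.
apply/forallPn; exists (dot_graph n w); rewrite negb_or; apply/andP; split;
  apply/existsPn => S; apply/negP => /andP[/eqP cS].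
- move=> /forall_inP cl; have : d.+2 <= d.+1; last by rewrite ltnn.
  rewrite -[leqLHS]cS cardE -(size_map (fun x : 'I_n => nth (0, 0)%R w x)).
  apply: size_pairwise_dot1 => [|t /mapP[x _ ->]]; last first.
    by apply: (allP wP); rewrite mem_nth // sw.
  rewrite pairwise_map.
  have := pairwise_enum_ord S; apply: sub_in_pairwise (allss _) => x y.
  rewrite !mem_enum => xS yS xy; rewrite /= -mem_dot_graph //.
  by have /forall_inP/(_ y yS)/implyP-> := cl x xS; rewrite // neq_ltn xy.
- move=> /forall_inP ind; suff : 0 < orth_subseqs 0%R w k by rewrite w0.
  rewrite -cS cardE -(size_map (fun x : 'I_n => nth (0, 0)%R w x)).
  apply: orth_subseqs_gt0.
  + rewrite -[X in subseq _ X](mkseq_nth (0, 0)%R) sw /mkseq -val_enum_ord.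
    by rewrite -map_comp; apply: map_subseq; rewrite [enum S]/enum_mem -enumT filter_subseq.
  + rewrite pairwise_map.
    have := pairwise_enum_ord S; apply: sub_in_pairwise (allss _) => x y.
    rewrite !mem_enum => xS yS xy; rewrite /= -mem_dot_graph //.
    by have /forall_inP/(_ y yS)/implyP-> := ind x xS; rewrite // neq_ltn xy.
  + by apply/allP => t _; rewrite /orth sub0mx.
Qed.

(** * Numerical estimates *)

Lemma orth_bound_le (d k : nat) :
  orth_bound d k 0 <= 2 ^ (d.+1 * k + 'C(d.+1, 2)).
Proof.
rewrite leq_exp2l // leq_add2l.
elim: k d => [|k IHk] [|d]; rewrite ?big_ord0 //.
  by rewrite big1.
rewrite big_ord_recl binS bin1 addn0 subn0 addnC leq_add2r.
by apply: leq_trans (IHk d); apply: leq_sum => i _.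
Qed.

(** Every factor of [k!] beyond 64 exceeds [2 ^ 6], and [6 * (k - 64) >= 5 * k] exactly when
    [k >= 384]. *)
Lemma fact_ge_exp (k : nat) : 384 <= k -> 2 ^ (5 * k) <= k`!.
Proof.
move=> hk; apply: (@leq_trans (64 ^ (k - 64))).
  by rewrite (_ : 64 = 2 ^ 6) // -expnM leq_exp2l //; lia.
elim: k {hk} => // k IHk; have [lek|ltk] := leqP k.+1 64.
  by rewrite (eqP lek) fact_gt0.
by rewrite subSn // expnS factS leq_mul // ltnW.
Qed.

Lemma ffact_le_exp (n k : nat) : n ^_ k <= n ^ k.
Proof. by elim: k => // k IHk; rewrite ffactnSr expnSr leq_mul // leq_subr. Qed.

Lemma ramsey_prop_gt_exp (d k n : nat) :
  384 <= k -> n ^ k * 2 ^ (d.+2 * k + 'C(d.+1, 2)) < 2 ^ (2 * d * k + 5 * k) ->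
  ~~ ramsey_prop d.+2 k n.
Proof.
move=> hk lt; apply: ramsey_prop_gt.
have gt0 e : 0 < 2 ^ e by rewrite expn_gt0.
(* The factor [2 ^ k] compensates for [selforth d] having only about half of all pairs;
   [2 ^ (5 * k)] is absorbed by the factorial, as ['C(n, k) * k!] is at most [n ^ k]. *)
rewrite -(ltn_pmul2r (gt0 k)) -(ltn_pmul2r (gt0 (5 * k))).
apply: (@leq_trans (2 ^ (2 * d * k + 5 * k))); last first.
  rewrite expnD; apply: leq_mul => //.
  rewrite expnM -expnMn [_ * 2]mulnC leq_exp2r ?card_selforth //.
  exact: leq_trans hk.
apply: leq_ltn_trans lt.
apply: (@leq_trans ('C(n, k) * k`! * 2 ^ (d.+2 * k + 'C(d.+1, 2)))); last first.
  by rewrite bin_ffact leq_mul2r ffact_le_exp orbT.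
have -> : 2 ^ (d.+2 * k + 'C(d.+1, 2)) = 2 ^ k * 2 ^ (d.+1 * k + 'C(d.+1, 2)).
  by rewrite -expnD addnA -mulSn.
rewrite [leqRHS]mulnACA [k`! * _]mulnC [leqRHS]mulnA.
apply: leq_mul; last exact: fact_ge_exp.
by rewrite [leqRHS]mulnAC leq_mul2r leq_mul2l orth_bound_le !orbT.
Qed.

(** * Passage to real exponents *)

Local Open Scope R_scope.

Lemma INR_expn (m e : nat) : INR (m ^ e)%N = INR m ^ e.
Proof. by elim: e => // e IHe; rewrite expnS mult_INR IHe. Qed.

Lemma INR_exp2 (e : nat) : INR (2 ^ e)%N = Rpower 2 (INR e).
Proof. by rewrite INR_expn Rpower_pow //; lra. Qed.

Lemma nat_floorP (x : R) :
  0 <= x -> INR (nat_floor x) <= x < INR (nat_floor x) + 1.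
Proof.
move=> x0; have [h1 h2] := base_Int_part x.
have h0 : Z.le Z0 (Int_part x).
  have : IZR (-1) < IZR (Int_part x) by lra.
  by move/lt_IZR; Lia.lia.
rewrite /nat_floor INR_IZR_INZ Znat.Z2Nat.id //; lra.
Qed.

Lemma INR_bin2 (d : nat) : 2 * INR 'C(d.+1, 2) = INR d * (INR d + 1).
Proof.
elim: d => [|d IHd]; first by rewrite /=; lra.
by rewrite binS bin1 plus_INR Rmult_plus_distr_l IHd S_INR; lra.
Qed.

Theorem theorem1p4 (C : R) (hC : 1 < C) :
  exists s0 : nat, forall s : nat, (s0 <= s)%N ->
    (Rpower 2 (1 - / (2 * C))) ^ s <= INR (ramsey s (nat_floor (C * INR s))).
Proof.
(* The threshold is that of [fact_ge_exp], which applies because [k >= s]. *)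
exists 384%N => s hs.
set k := nat_floor _; set n := ramsey s k.
have s0 : 0 <= INR s := pos_INR s.
have [kle kgt] : INR k <= C * INR s < INR k + 1 by apply: nat_floorP; nra.
have sk : (s <= k)%N.
  apply/leP/INR_le/Rnot_lt_le => /INR_lt/le_INR; rewrite S_INR; nra.
apply: Rnot_lt_le => ltn.
have := ramsey_propP s k; rewrite -/n.
case: s hs @k @n s0 kle kgt sk ltn => [|[|d]] // hs k n s0 kle kgt sk ltn.
apply/negP; apply: ramsey_prop_gt_exp; first exact: leq_trans sk.
apply/ltP/INR_lt; rewrite mult_INR INR_expn !INR_exp2.
set s := d.+2 in ltn s0 kle kgt sk *.
have nk : INR n ^ k <= Rpower 2 (INR s * INR k * (1 - / (2 * C))).
  rewrite Rmult_assoc [INR k * _]Rmult_comm -Rmult_assoc.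
  have X0 : 0 < Rpower 2 (1 - / (2 * C)) by apply: exp_pos.
  rewrite [INR s * _]Rmult_comm -2!Rpower_mult !Rpower_pow //; last exact: pow_lt.
  by apply: pow_incr; split; [apply: pos_INR | lra].
apply: Rle_lt_trans.
  by apply: Rmult_le_compat_r nk; apply/Rlt_le/exp_pos.
rewrite -Rpower_plus; apply: Rpower_lt; first lra.
(* From [k > C * s - 1] one gets [s * k / (2 * C) >= s ^ 2 / 2 - s / (2 * C)], and [C > 1] bounds
   the last term by [s / 2]. *)
have Cinv : INR s * INR k * / (2 * C) >= INR s * INR s / 2 - INR s / 2.
  apply/Rle_ge/(Rmult_le_reg_r (2 * C)); first lra.
  by rewrite [X in _ <= X]Rmult_assoc Rinv_l; nra.
have sE : INR s = INR d + 2 by rewrite !S_INR; lra.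
have skR : INR s <= INR k by apply/le_INR/leP.
have := INR_bin2 d; move: 'C(_, _) => B binE.
have -> : INR (s * k + B)%N = INR s * INR k + INR B by rewrite plus_INR mult_INR.
have -> : INR (2 * d * k + 5 * k)%N = 2 * INR d * INR k + 5 * INR k.
  by rewrite plus_INR !mult_INR (INR_IZR_INZ 2) (INR_IZR_INZ 5) /=.
have dE : INR d = INR s - 2 by lra.
have s2 : 2 <= INR s by have := pos_INR d; lra.
move: Cinv; set c := / (2 * C) => Cinv.
rewrite dE in binE *.
(* With [d = s - 2] the left exponent is at most [2 * s * k - s + 1], and the right one is
   [2 * s * k + k]: the gain [5 * k] outweighs the [4 * k] lost in [2 * d * k]. *)
nra.
Qed.
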